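(* Let $J\geq2$ be an integer, let $\mathrm{B}$ be a symplectic form on a vector space $\mathcal{V}$ over $\mathbb{F}_2$ of dimension $2J$, and let $\mathcal{D}$ be an affine quadric in $\mathcal{V}$ with $\#(\mathcal{D})=2^{J-1}(2^J+1)$, with complement $\mathcal{D}^{\mathrm{c}}=\mathcal{V}\setminus\mathcal{D}$. Then the ETFs $\Phi_{\mathcal{D}^{\mathrm{c}}}$, $\widehat{\Phi}_{\mathcal{D}^{\mathrm{c}}}$, $\Psi_{\mathcal{D}}$ and $\widehat{\Psi}_{\mathcal{D}}$ (defined in the context) are DTETFs.
   Context: A symplectic form is an alternating nondegenerate bilinear form. A function $\mathrm{Q}:\mathcal{V}\to\mathbb{F}_2$ is a quadratic form that yields $\mathrm{B}$ if $\mathrm{B}(v_1,v_2)=\mathrm{Q}(v_1+v_2)+\mathrm{Q}(v_1)+\mathrm{Q}(v_2)$ for all $v_1,v_2\in\mathcal{V}$; its quadric is $\{v\in\mathcal{V}:\mathrm{Q}(v)=0\}$. A subset $\mathcal{D}\subseteq\mathcal{V}$ is an affine quadric if either $\mathcal{D}$ or its complement is the quadric of some quadratic form that yields $\mathrm{B}$. ETFs: a finite sequence $(\varphi_n)_{n\in\mathcal{N}}$ in a real Hilbert space is an equiangular tight frame (ETF) if $\|\varphi_n\|^2=S$ for all $n$ for some $S>0$, $|\langle\varphi_{n_1},\varphi_{n_2}\rangle|^2=C$ for all $n_1\neq n_2$ for some $C>0$, and for some $A>0$, $\sum_n\langle\varphi_n,y\rangle\varphi_n=Ay$ for all $y$ in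 its span. The sequences: $\Phi=(\varphi_v)_{v\in\mathcal{V}}$ in $\mathbb{R}^{\mathcal{D}}$ and $\Psi=(\psi_v)_{v\in\mathcal{V}}$ in $\mathbb{R}^{\mathcal{D}^{\mathrm{c}}}$ are given by $\varphi_{v_2}(v_1)=2^{-(J-1)/2}(-1)^{\mathrm{B}(v_1,v_2)}$ for $v_1\in\mathcal{D}$, and $\psi_{v_2}(v_1)=2^{-(J-1)/2}(-1)^{\mathrm{B}(v_1,v_2)}$ for $v_1\in\mathcal{D}^{\mathrm{c}}$. Put $\Phi_{\mathcal{D}^{\mathrm{c}}}=(\varphi_v)_{v\in\mathcal{D}^{\mathrm{c}}}$ and $\Psi_{\mathcal{D}}=(\psi_v)_{v\in\mathcal{D}}$. It is known that these are ETFs, with: for $v_1,v_2\in\mathcal{D}^{\mathrm{c}}$, $\langle\varphi_{v_1},\varphi_{v_2}\rangle=2^J+1$ if $v_1=v_2$ and $(-1)^{\mathrm{B}(v_1,v_2)}$ otherwise; for $v_1,v_2\in\mathcal{D}$, $\langle\psi_{v_1},\psi_{v_2}\rangle=2^J-1$ if $v_1=v_2$ and $-(-1)^{\mathrm{B}(v_1,v_2)}$ otherwise. Their duals $\widehat{\Phi}_{\mathcal{D}^{\mathrm{c}}}=(\widehat{\varphi}_v)_{v\in\mathcal{D}^{\mathrm{c}}}$ and $\widehat{\Psi}_{\mathcal{D}}=(\widehat{\psi}_v)_{v\in\mathcal{D}}$ are sequences in real Hilbert spaces (unique up to isometry of spans) with Gram matrices: $\langle\widehat{\varphi}_{v_1},\widehat{\varphi}_{v_2}\rangle=2^{J-1}-1$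 if $v_1=v_2$ and $-(-1)^{\mathrm{B}(v_1,v_2)}$ otherwise; $\langle\widehat{\psi}_{v_1},\widehat{\psi}_{v_2}\rangle=2^{J-1}+1$ if $v_1=v_2$ and $(-1)^{\mathrm{B}(v_1,v_2)}$ otherwise. These are also ETFs. The spans of $\Phi_{\mathcal{D}^{\mathrm{c}}}$, $\widehat{\Phi}_{\mathcal{D}^{\mathrm{c}}}$, $\Psi_{\mathcal{D}}$, $\widehat{\Psi}_{\mathcal{D}}$ have dimensions $\frac13(2^{2J}-1)$, $\frac13(2^{J-1}-1)(2^J-1)$, $\frac13(2^{2J}-1)$, $\frac13(2^{J-1}+1)(2^J+1)$, respectively. DTETF: an equal norm finite sequence $(\varphi_n)_{n\in\mathcal{N}}$ whose span has dimension less than $\#(\mathcal{N})$ and whose symmetry group acts doubly transitively on $\mathcal{N}$. Here the symmetry group is the group of all permutations $\sigma$ of $\mathcal{N}$ for which there exist unimodular scalars $(z_n)_{n\in\mathcal{N}}$ (here $z_n\in\{1,-1\}$) with $\langle\varphi_{\sigma(n_1)},\varphi_{\sigma(n_2)}\rangle=\overline{z_{n_1}}z_{n_2}\langle\varphi_{n_1},\varphi_{n_2}\rangle$ for all $n_1\neq n_2$; doubly transitive means for all $n_1\neq n_2$ and $n_3\neq n_4$ in $\mathcal{N}$ some symmetry $\sigma$ has $\sigma(n_1)=n_3$ and $\sigma(n_2)=n_4$. *)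

(* Defs.v *)
From HB Require Import structures.
From mathcomp Require Import all_boot all_order all_fingroup all_algebra all_field.
From mathcomp Require Import all_classical all_reals all_analysis.

Set Implicit Arguments.
Unset Strict Implicit.
Unset Printing Implicit Defensive.

Import Order.TTheory GRing.Theory Num.Theory.

Local Open Scope ring_scope.

Section RealHilbert.
Variables (R : realType) (H : lmodType R) (dot : {dot H for idfun}).

Definition hnorm (x : H) : R := Num.sqrt (dot x x).

(* A real Hilbert space is a real vector space H with an inner product dot
   such that [hilbert dot] holds; no bound on the dimension of H is assumed. *)
Definition hilbert : Prop :=
  forall x : nat -> H,
    (forall e : R, 0 < e ->
       exists k, forall m n, (k <= m)%N -> (k <= n)%N -> hnorm (x m - x n) < e) ->
    exists l : H, forall e : R, 0 < e ->
       exists k, forall n, (k <= n)%N -> hnorm (x n - l) < e.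

End RealHilbert.

Section FiniteSequences.
Variables (R : realType) (H : lmodType R).

Definition in_span (N : finType) (phi : N -> H) (y : H) : Prop :=
  exists c : N -> R, y = \sum_n c n *: phi n.

Definition lin_indep (N : finType) (phi : N -> H) : Prop :=
  forall c : N -> R, \sum_n c n *: phi n = 0 -> forall n, c n = 0.

(* H may be infinite-dimensional, so \dim of vector.v does not apply. *)
Definition span_has_dim (N : finType) (phi : N -> H) (d : nat) : Prop :=
  exists e : 'I_d -> H,
    lin_indep e /\ forall y, in_span e y <-> in_span phi y.

Variables (dot : {dot H for idfun}) (N : finType) (phi : N -> H).

Definition equal_norm : Prop :=
  exists2 S : R, 0 < S & forall n, hnorm dot (phi n) ^+ 2 = S.

Definition equiangular : Prop :=
  exists2 C : R, 0 < C &
    forall n1 n2, n1 != n2 -> `|dot (phi n1) (phi n2)| ^+ 2 = C.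

Definition tight_for_span : Prop :=
  exists2 A : R, 0 < A &
    forall y, in_span phi y -> \sum_n dot (phi n) y *: phi n = A *: y.

Definition is_ETF : Prop := [/\ equal_norm, equiangular & tight_for_span].

Definition is_symmetry (s : {perm N}) : Prop :=
  exists z : N -> R,
    (forall n, `|z n| = 1) /\
    forall n1 n2, n1 != n2 ->
      dot (phi (s n1)) (phi (s n2)) = z n1 * z n2 * dot (phi n1) (phi n2).

Definition doubly_transitive_symmetries : Prop :=
  forall n1 n2 n3 n4 : N, n1 != n2 -> n3 != n4 ->
    exists s : {perm N}, [/\ is_symmetry s, s n1 = n3 & s n2 = n4].

Definition is_DTETF : Prop :=
  [/\ equal_norm,
      exists2 d, span_has_dim phi d & (d < #|N|)%N
    & doubly_transitive_symmetries].

End FiniteSequences.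

Section EuclideanSpace.
Variables (R : realType) (I : finType).

(* {ffun I -> R^o} is R^I with its standard inner product. *)
Definition edot (x y : {ffun I -> R^o}) : R := \sum_i x i * y i.

Fact edot_bilinear : bilinear_for *%R (idfun \; *%R) edot.
Proof.
split=> [y|x] a u v.
  rewrite /= /edot mulr_sumr -big_split; apply: eq_bigr => i _.
  by rewrite !ffunE mulrDl -mulrA.
rewrite /= /edot mulr_sumr -big_split; apply: eq_bigr => i _.
by rewrite !ffunE mulrDr mulrCA.
Qed.

HB.instance Definition _ :=
  bilinear_isBilinear.Build R {ffun I -> R^o} {ffun I -> R^o} R
    *%R (idfun \; *%R) edot edot_bilinear.

Fact edot_sym (x y : {ffun I -> R^o}) :
  edot x y = (-1) ^+ false * idfun (edot y x).
Proof.
by rewrite expr0 mul1r /=; apply: eq_bigr => i _; rewrite mulrC.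
Qed.

HB.instance Definition _ :=
  isHermitianSesquilinear.Build R {ffun I -> R^o} false idfun edot edot_sym.

Fact edot_gt0 (x : {ffun I -> R^o}) : x != 0 -> 0 < edot x x.
Proof.
move=> x_neq0; rewrite lt_neqAle sumr_ge0 ?andbT => [|i _]; last exact: sqr_ge0.
apply: contra x_neq0 => /eqP /esym x0; apply/eqP/ffunP => i; rewrite ffunE.
suff /eqP : x i * x i = 0 by rewrite mulf_eq0 orbb => /eqP.
by apply: (psumr_eq0P _ x0) => // j _; exact: sqr_ge0.
Qed.

HB.instance Definition _ :=
  isDotProduct.Build R {ffun I -> R^o} edot edot_gt0.

End EuclideanSpace.

Section AffineQuadrics.
(* finvect_type V is V itself, with the finType structure that it inherits
   from the finiteness of 'F_2. *)
Variables (V : vectType 'F_2) (B : V -> V -> 'F_2).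

Definition yields (Q : V -> 'F_2) : Prop :=
  forall v1 v2 : V, B v1 v2 = Q (v1 + v2) + Q v1 + Q v2.

Definition quadric (Q : V -> 'F_2) : {set finvect_type V} :=
  [set v : finvect_type V | Q v == 0].

Definition affine_quadric (D : {set finvect_type V}) : Prop :=
  exists2 Q, yields Q & D = quadric Q \/ ~: D = quadric Q.

Definition chi (R : realType) (v1 v2 : V) : R := (-1) ^+ (B v1 v2 : nat).

(* The vector of R^E with entries 2 ^ (-(J-1)/2) * (-1) ^ B(v1, v2), v1 in E:
   phi_v2 for E = D, and psi_v2 for E = ~: D. *)
Definition chi_vec (R : realType) (J : nat) (E : {set finvect_type V})
    (v2 : V) : {ffun {v : finvect_type V | v \in E} -> R^o} :=
  [ffun v1 : {v : finvect_type V | v \in E} =>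
     2 `^ (- (J%:R - 1) / 2) * chi R (val v1) v2 : R^o].

Definition Phi_compl (R : realType) (J : nat) (D : {set finvect_type V})
    (v : {v : finvect_type V | v \in ~: D}) :=
  chi_vec R J D (val v).

Definition Psi_quadric (R : realType) (J : nat) (D : {set finvect_type V})
    (v : {v : finvect_type V | v \in D}) :=
  chi_vec R J (~: D) (val v).

(* The duals are determined, up to an isometry of their spans, by their Gram
   matrices, so they are represented by any sequence, in any real Hilbert
   space, that has the Gram matrix in question. *)
Definition is_dual_Phi (R : realType) (J : nat) (D : {set finvect_type V})
    (H : lmodType R) (dot : {dot H for idfun})
    (f : {v : finvect_type V | v \in ~: D} -> H) : Prop :=
  forall v1 v2, dot (f v1) (f v2) =
    if v1 == v2 then 2 ^+ J.-1 - 1 else - chi R (val v1) (val v2).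

Definition is_dual_Psi (R : realType) (J : nat) (D : {set finvect_type V})
    (H : lmodType R) (dot : {dot H for idfun})
    (f : {v : finvect_type V | v \in D} -> H) : Prop :=
  forall v1 v2, dot (f v1) (f v2) =
    if v1 == v2 then 2 ^+ J.-1 + 1 else chi R (val v1) (val v2).

End AffineQuadrics.

Arguments Phi_compl {V} B R J D v.
Arguments Psi_quadric {V} B R J D v.

(* Main.v *)
(* Let Q yield B and let E be a level set of Q. Swapping v and v + u whenever
   both lie in E, and fixing the other points of E, preserves B on E up to
   signs, so each u induces a symmetry. The one with u = p + q exchanges p and q,
   and one or two of them move p to q while fixing a given third point, so the
   symmetries are doubly transitive on E.
   Expanding the indicator of E in terms of (-1)^Q shows that the matrix of
   signs (-1)^B on E satisfies a quadratic equation, which gives tightness; and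
   a tight frame whose distinct vectors are never orthogonal is linearly
   dependent. *)
Require Import Defs.
From mathcomp Require Import all_boot all_order all_fingroup all_algebra all_field.
From mathcomp Require Import all_classical all_reals all_analysis.
From mathcomp Require Import ring lra.

Set Implicit Arguments.
Unset Strict Implicit.
Unset Printing Implicit Defensive.

Import Order.TTheory GRing.Theory Num.Theory.

Local Open Scope ring_scope.

(** * Tightness, dependence and span dimension in a real inner product space *)

Section Frames.
Variables (R : realType) (H : lmodType R) (dot : {dot H for idfun}).
Variables (N : finType) (phi : N -> H).

Lemma dot_eq0 (x : H) : dot x x = 0 -> x = 0.
Proof.
move=> x0; apply/eqP/negPn/negP => /(neq0_dnorm_gt0 (s := dot)).
by rewrite x0 ltxx.
Qed.

Lemma hnorm_sqr (x : H) : hnorm dot x ^+ 2 = dot x x.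
Proof.
rewrite /hnorm sqr_sqrtr //; have [->|x0] := eqVneq x 0; first by rewrite linear0r.
exact/ltW/neq0_dnorm_gt0.
Qed.

(** Once the Gram matrix squares to [A] times itself, the defect of the frame identity at [phi m] is
    orthogonal to every [phi k]. Being a combination of these vectors, it is orthogonal to itself,
    hence zero; linearity does the rest. *)
Lemma tight_for_span_gram (A : R) : 0 < A ->
  (forall k m, \sum_n dot (phi k) (phi n) * dot (phi n) (phi m)
     = A * dot (phi k) (phi m)) ->
  tight_for_span dot phi.
Proof.
move=> A_gt0 gram2; exists A => //.
have frame m : \sum_n dot (phi n) (phi m) *: phi n = A *: phi m.
  apply/eqP; rewrite -subr_eq0; apply/eqP; set e := _ - _.
  have e_orth k : dot (phi k) e = 0.
    rewrite /e linearBr linear_sumr linearZr_LR /= -gram2; apply/eqP.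
    rewrite subr_eq0; apply/eqP/eq_bigr => n _.
    by rewrite linearZr_LR /= mulrC.
  apply: dot_eq0; rewrite {1}/e linearBl linear_sumlz linearZl_LR /=.
  rewrite e_orth mulr0 subr0.
  by apply: big1 => n _; rewrite linearZl_LR /= e_orth mulr0.
move=> _ [c ->].
transitivity (\sum_m c m *: (\sum_n dot (phi n) (phi m) *: phi n)).
  under [RHS]eq_bigr do rewrite scaler_sumr.
  rewrite exchange_big; apply: eq_bigr => n _.
  rewrite linear_sumr scaler_suml; apply: eq_bigr => m _.
  by rewrite linearZr_LR /= scalerA.
rewrite scaler_sumr; apply: eq_bigr => m _.
by rewrite frame !scalerA mulrC.
Qed.

(** The frame identity at [phi n2] is a linear relation whose coefficient at [phi n1] is
    [dot (phi n1) (phi n2)], nonzero by equiangularity. *)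
Lemma tight_equiangular_dependent (n1 n2 : N) : n1 != n2 ->
  equiangular dot phi -> tight_for_span dot phi -> ~ lin_indep phi.
Proof.
move=> n12 [C C_gt0 equi] [A _ tight] indep.
have : \sum_n (dot (phi n) (phi n2) - (n == n2)%:R * A) *: phi n = 0.
  under eq_bigr do rewrite scalerBl.
  rewrite big_split /= sumrN tight; last first.
    exists (fun n => (n == n2)%:R); rewrite (bigD1 n2) //= eqxx scale1r big1 ?addr0 //.
    by move=> n /negbTE ->; rewrite scale0r.
  rewrite (bigD1 n2) //= eqxx mul1r big1 ?addr0 ?subrr // => n /negbTE ->.
  by rewrite mul0r scale0r.
move=> /indep /(_ n1); rewrite (negbTE n12) mul0r subr0 => orth.
by move: C_gt0; rewrite -(equi _ _ n12) orth normr0 expr0n ltxx.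
Qed.

(** A maximal independent set [S] of indices gives a basis of the span, and dependence of the whole
    sequence makes [S] proper. *)
Lemma dependent_span_dim : ~ lin_indep phi ->
  exists2 d, span_has_dim phi d & (d < #|N|)%N.
Proof.
(* Coefficients live on all of [N] and vanish off [S], so that different index sets share one
   type. *)
pose indep_on (S : {set N}) := `[< forall c : N -> R,
  (forall n, n \notin S -> c n = 0) -> \sum_n c n *: phi n = 0 ->
  forall n, c n = 0 >].
have : exists S, indep_on S.
  by exists finset.set0; apply/asboolP => c c0 _ n; apply: c0; rewrite finset.inE.
move=> /ex_maxset [S /maxsetP[/asboolP indepS maxS]] dep.
have ext (c : 'I_#|S| -> R) : exists2 c' : N -> R,
    (forall n, n \notin S -> c' n = 0) & forall i, c' (enum_val i) = c i.
  exists (fun n => \sum_(i < #|S| | enum_val i == n) c i).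
    move=> n nS; rewrite big_pred0 // => i; apply/negP => /eqP iE.
    by move: nS; rewrite -iE enum_valP.
  by move=> i; rewrite (big_pred1 i) // => j; rewrite (inj_eq enum_val_inj).
have sumS (c : N -> R) : (forall n, n \notin S -> c n = 0) ->
    \sum_n c n *: phi n = \sum_(i < #|S|) c (enum_val i) *: phi (enum_val i).
  move=> c0; rewrite -(big_enum_val (A := mem S) (fun n => c n *: phi n)) /=.
  rewrite [RHS]big_mkcond; apply: eq_bigr => n _.
  by case: ifPn => // /c0 ->; rewrite scale0r.
have spanS n : in_span (fun i : 'I_#|S| => phi (enum_val i)) (phi n).
  have [nS|nS] := boolP (n \in S).
    exists (fun i => (enum_val i == n)%:R).
    rewrite -(sumS (fun k => (k == n)%:R)); last first.
      by move=> k kS; case: eqVneq => // kn; rewrite kn nS in kS.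
    rewrite (bigD1 n) //= eqxx scale1r big1 ?addr0 // => k /negbTE ->.
    by rewrite scale0r.
  (* By maximality, adding [n] to [S] creates a nontrivial relation. Its coefficient at [n] is
     nonzero, since otherwise it would be a relation on [S]. *)
  have [c [c0 csum [k ck]]] : exists c : N -> R,
      [/\ forall k, k \notin n |: S -> c k = 0, \sum_n c n *: phi n = 0
        & exists k, c k != 0].
    apply: contrapT => noc; case/negP: nS.
    rewrite -(maxS (n |: S) _ (finset.subsetUr _ _)) ?finset.setU11 //.
    apply/asboolP => c c0 csum k; apply/eqP/negPn/negP => ck.
    by apply: noc; exists c; split=> //; exists k.
  have cn : c n != 0.
    apply: contra ck => /eqP cn; apply/eqP; move: k; apply: indepS => // k kS.
    by have [->|kn] := eqVneq k n; last apply: c0; rewrite ?finset.inE ?(negbTE kn).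
  (* The relation solved for [phi n]; the value 0 at [n] keeps [b] supported on [S]. *)
  pose b k := - (c n)^-1 * (if k == n then 0 else c k).
  exists (fun i => b (enum_val i)); rewrite -(sumS b) /b; last first.
    move=> j jS; have [_|jn] := eqVneq j n; first by rewrite mulr0.
    by rewrite (c0 j) ?mulr0 // !finset.inE negb_or jn.
  transitivity (\sum_k (((k == n)%:R - (c n)^-1 * c k) *: phi k)).
    under eq_bigr do rewrite scalerBl.
    rewrite big_split /= sumrN -[X in _ - X](_ : (c n)^-1 *: (\sum_k c k *: phi k) = _).
      rewrite csum scaler0 subr0 (bigD1 n) //= eqxx scale1r big1 ?addr0 //.
      by move=> j /negbTE ->; rewrite scale0r.
    by rewrite scaler_sumr; apply: eq_bigr => j _; rewrite scalerA.
  apply: eq_bigr => j _; case: eqVneq => [->|_]; last by rewrite sub0r mulNr.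
  by rewrite mulVf // subrr mulr0.
exists #|S|; last first.
  rewrite ltn_neqAle max_card andbT; apply/eqP => cardS; apply: dep.
  have SE : S = finset.setT.
    by apply/eqP; rewrite eqEcard finset.subsetT cardsT cardS leqnn.
  by move=> c; apply: indepS => n; rewrite SE finset.in_setT.
exists (fun i => phi (enum_val i)); split.
  move=> c csum i; have [c' c'0 c'c] := ext c.
  rewrite -c'c; apply: indepS => //; rewrite sumS // -[RHS]csum.
  by apply: eq_bigr => j _; rewrite c'c.
move=> y; split=> [[c ->]|[c ->]].
  have [c' c'0 c'c] := ext c; exists c'; rewrite sumS //.
  by apply: eq_bigr => j _; rewrite c'c.
have [d dE] := choice spanS.
exists (fun i => \sum_n c n * d n i).
under [RHS]eq_bigr do rewrite scaler_suml.
rewrite exchange_big; apply: eq_bigr => n _; rewrite dE scaler_sumr.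
by apply: eq_bigr => i _; rewrite scalerA.
Qed.

Lemma is_symmetryM (s t : {perm N}) :
  is_symmetry dot phi s -> is_symmetry dot phi t -> is_symmetry dot phi (s * t)%g.
Proof.
move=> [y [y1 ys]] [z [z1 zt]]; exists (fun n => y n * z (s n)); split.
  by move=> n; rewrite normrM y1 z1 mulr1.
move=> n1 n2 n12; rewrite !permM zt ?ys ?(inj_eq perm_inj) //; ring.
Qed.

End Frames.

(** * Sums over subtypes, and signs of elements of F_2 *)

Lemma sum_sig (M : nmodType) (T : finType) (A : {set T}) (F : T -> M) :
  \sum_(x : {x | x \in A}) F (val x) = \sum_(x in A) F x.
Proof.
rewrite [RHS](reindex_omap (val : {x | x \in A} -> T) insub) => [|x xA].
  by apply: eq_bigl => x; rewrite valK eqxx (valP x).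
by rewrite insubT.
Qed.

Lemma F2_cases (x : 'F_2) : x = 0 \/ x = 1.
Proof. by case: x => [[|[|//]]] ?; [left | right]; apply: val_inj. Qed.

Lemma F2_addxx (x : 'F_2) : x + x = 0.
Proof. by case: (F2_cases x) => ->; apply: val_inj. Qed.

Section Sign.
Variable R : realType.

Definition sg (x : 'F_2) : R := (-1) ^+ (x : nat).

Lemma sg0 : sg 0 = 1. Proof. exact: expr0. Qed.
Lemma sg1 : sg 1 = -1. Proof. exact: expr1. Qed.

Lemma sgD (x y : 'F_2) : sg (x + y) = sg x * sg y.
Proof.
case: (F2_cases x) => ->; first by rewrite add0r sg0 mul1r.
case: (F2_cases y) => ->; first by rewrite addr0 sg0 mulr1.
by rewrite F2_addxx sg0 sg1 mulN1r opprK.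
Qed.

Lemma sg_sqr (x : 'F_2) : sg x * sg x = 1.
Proof. by rewrite -sgD F2_addxx sg0. Qed.

Lemma norm_sg (x : 'F_2) : `|sg x| = 1.
Proof. by rewrite normrX normrN1 expr1n. Qed.

(** Fourier expansion of an indicator on F_2; it turns a sum over a level set of [Q] into sums over
    the whole space. *)
Lemma sg_eq (x y : 'F_2) : (x == y)%:R = (1 + sg x * sg y) / 2.
Proof.
by case: (F2_cases x) => ->; case: (F2_cases y) => ->;
  rewrite ?sg0 ?sg1 /=; field.
Qed.

End Sign.

(** * Inner products of the character vectors *)

Lemma powR_half_sqr (R : realType) (J : nat) : (0 < J)%N ->
  (2 : R) `^ (- (J%:R - 1) / 2) * 2 `^ (- (J%:R - 1) / 2) = (2 ^+ J.-1)^-1.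
Proof.
move=> J_gt0; set r := - (J%:R - 1) / 2; rewrite -(@powRD R 2 r r); last first.
  by apply/implyP.
rewrite -(powR_mulrn J.-1 (ler0n R 2)) -powRN /r; congr (_ `^ _).
by rewrite -subn1 natrB //; field.
Qed.

Lemma edot_chi_vec (R : realType) (J : nat) (V : vectType 'F_2)
    (B : V -> V -> 'F_2) (E : {set finvect_type V}) (v w : V) : (0 < J)%N ->
  edot (chi_vec B R J E v) (chi_vec B R J E w)
    = (2 ^+ J.-1)^-1 * \sum_(x in E) chi B R x v * chi B R x w.
Proof.
move=> J_gt0; rewrite -(sum_sig E (fun x => chi B R x v * chi B R x w)) mulr_sumr.
apply: eq_bigr => x _; rewrite !ffunE -powR_half_sqr //.
exact: mulrACA.
Qed.

(** * Symplectic forms over F_2 *)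

Section Symplectic.
Variables (R : realType) (V : vectType 'F_2) (B : {skew_symmetric V}).
Hypothesis B_symplectic : is_psymplectic B.
Local Notation W := (finvect_type V).
Local Notation sg := (sg R).

Lemma addvv (u : V) : u + u = 0.
Proof. by rewrite -[u]scale1r -scalerDl F2_addxx scale0r. Qed.

Lemma addvvK (u v : V) : v + u + u = v.
Proof. by rewrite -addrA addvv addr0. Qed.

Lemma addv_eq0 (u v : V) : (u + v == 0) = (u == v).
Proof. by rewrite -(inj_eq (addIr v)) addvvK add0r. Qed.

Lemma formDl (u v w : V) : B (u + v) w = B u w + B v w.
Proof. exact: linearDl. Qed.

Lemma formDr (u v w : V) : B w (u + v) = B w u + B w v.
Proof. exact: linearDr. Qed.

Lemma symplectic_alt (u : V) : B u u = 0.
Proof. by case: B_symplectic => _ _; apply; exact: pchar_Fp. Qed.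

Lemma symplecticC (u v : V) : B u v = B v u.
Proof.
by rewrite hermC expr1 mulN1r; apply/eqP; rewrite eq_sym -addr_eq0 F2_addxx.
Qed.

Lemma symplectic_neq0 (u : V) : u != 0 -> exists v, B u v = 1.
Proof.
move=> u0; apply: contrapT => noB; case: B_symplectic => nondeg _ _.
case/negP: u0; rewrite -memv0 -(eqP nondeg); apply/mem_orthovP => v _.
by case: (F2_cases (B u v)) => // Buv; case: noB; exists v.
Qed.

(** The hyperplanes orthogonal to [a] and to [b] do not cover the space: if neither [y] nor [z]
    avoids both, then [y + z] does. *)
Lemma symplectic_neq0_2 (a b : V) : a != 0 -> b != 0 ->
  exists x, B a x = 1 /\ B b x = 1.
Proof.
move=> /symplectic_neq0 [y ay] /symplectic_neq0 [z bz].
case: (F2_cases (B b y)) => by_; last by exists y.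
case: (F2_cases (B a z)) => az; last by exists z.
by exists (y + z); rewrite !formDr ay az by_ bz addr0 add0r.
Qed.

(** Orthogonality of characters: for nonzero [u], translation by some [v] with [B u v = 1] negates
    the sum. *)
Lemma sum_sg_symplectic (u : V) :
  \sum_(x : W) sg (B x u) = #|W|%:R * (u == 0)%:R.
Proof.
have [->|/symplectic_neq0 [v uv]] := eqVneq u 0.
  under eq_bigr do rewrite linear0r sg0.
  by rewrite sumr_const mulr1.
rewrite mulr0; set S := \sum_x _.
have : S = - S; last by lra.
rewrite {1}/S (reindex_inj (addIr (v : W))) -sumrN; apply: eq_bigr => x _.
by rewrite formDl [B v u]symplecticC uv sgD sg1 mulrN1.
Qed.

(** * Character sums over a level set [E] of a quadratic form *)

Section LevelSet.
Variables (Q : V -> 'F_2) (e : 'F_2) (E : {set W}).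
Hypotheses (QB : yields B Q) (EQ : forall v : W, (v \in E) = (Q v == e)).

Lemma yieldsD (v w : V) : Q (v + w) = B v w + Q v + Q w.
Proof. by rewrite QB -!addrA (addrCA (Q w)) F2_addxx addr0 F2_addxx addr0. Qed.

Lemma sum_sg_level (u : V) :
  2 * (\sum_(x in E) sg (B x u))
    = #|W|%:R * (u == 0)%:R + (2 * #|E|%:R - #|W|%:R) * sg (Q u).
Proof.
pose S := \sum_(x : W) sg (Q x).
have sumE (F : W -> R) : 2 * (\sum_(x in E) F x) =
    \sum_(x : W) F x + sg e * \sum_(x : W) sg (Q x) * F x.
  rewrite big_mkcond !mulr_sumr -big_split; apply: eq_bigr => x _ /=.
  transitivity (2 * ((x \in E)%:R * F x)).
    by case: (x \in E); rewrite ?mul1r ?mul0r.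
  by rewrite EQ (sg_eq R); field.
(* Translating [x] by [u] absorbs the character [B x u] into [Q], as in completing the square. *)
have shift : \sum_(x : W) sg (Q x) * sg (B x u) = sg (Q u) * S.
  rewrite /S (reindex_inj (addIr (u : W))) mulr_sumr; apply: eq_bigr => x _.
  rewrite yieldsD formDl symplectic_alt addr0 !sgD; ring: (sg_sqr R (B x u)).
(* Taking the constant function 1 expresses the Gauss sum [S] through the size of [E]. *)
have -> : 2 * #|E|%:R = #|W|%:R + sg e * S.
  have := sumE (fun=> 1); rewrite !sumr_const => ->.
  by congr (_ + _ * _); apply: eq_bigr => x _; rewrite mulr1.
rewrite sumE sum_sg_symplectic shift; ring.
Qed.

(** This is the quadratic equation of the sign matrix on [E]: with [u = v + w], the equal values
    [Q v] and [Q w] cancel, leaving [Q u = B v w]. *)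
Lemma sum_chi_level (v w : W) : v \in E -> w \in E ->
  2 * (\sum_(x in E) chi B R v x * chi B R x w)
    = #|W|%:R * (v == w)%:R + (2 * #|E|%:R - #|W|%:R) * chi B R v w.
Proof.
rewrite !EQ => /eqP Qv /eqP Qw.
under eq_bigr => x _ do
  rewrite /chi [B v _]symplecticC -/(sg _) -/(sg _) -sgD -formDr.
by rewrite sum_sg_level addv_eq0 yieldsD Qv Qw -addrA F2_addxx addr0.
Qed.

(** The same cancellation works off [E], because [Q] takes only one other value there. This gives
    the Gram matrices of sequences indexed by the complement of the set on which their vectors
    live. *)
Lemma sum_chi_level_compl (v w : W) : v \notin E -> w \notin E ->
  2 * (\sum_(x in E) chi B R x v * chi B R x w)
    = #|W|%:R * (v == w)%:R + (2 * #|E|%:R - #|W|%:R) * chi B R v w.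
Proof.
move=> vE wE.
under eq_bigr => x _ do rewrite /chi -/(sg _) -/(sg _) -sgD -formDr.
rewrite sum_sg_level addv_eq0 yieldsD -addrA (_ : Q v = Q w) ?F2_addxx ?addr0 //.
move: vE wE; rewrite !EQ; case: (F2_cases e) => ->;
  by case: (F2_cases (Q v)) => ->; case: (F2_cases (Q w)) => ->.
Qed.

Lemma edot_chi_vec_level (J : nat) (v w : W) :
  (0 < J)%N -> v \notin E -> w \notin E ->
  edot (chi_vec B R J E v) (chi_vec B R J E w)
    = (2 ^+ J.-1)^-1 * (#|W|%:R * (v == w)%:R
        + (2 * #|E|%:R - #|W|%:R) * chi B R v w) / 2.
Proof.
move=> J_gt0 vE wE; rewrite edot_chi_vec // -sum_chi_level_compl //.
by rewrite [2 * _]mulrC mulrA mulfK ?pnatr_eq0.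
Qed.

(** * Shift involutions of [E] and their signs *)

Lemma mem_level_shift (u v : W) : v \in E -> (v + u \in E) = (B u v == Q u).
Proof.
rewrite !EQ yieldsD symplecticC => /eqP ->.
by case: (F2_cases (B u v)) => ->; case: (F2_cases (Q u)) => ->;
   case: (F2_cases e) => ->.
Qed.

(* The transvection x |-> x + B(x, u) u permutes the quadratic forms
   Q + B(., v) that yield B, and this is its action on the parameter v. *)
Definition shift (u : V) (n : {v : W | v \in E}) : {v : W | v \in E} :=
  insubd n (val n + u : W).

Lemma val_shift (u : V) n :
  val (shift u n) = if val n + u \in E then val n + u else val n.
Proof. by rewrite val_insubd. Qed.

Lemma shiftK (u : V) : involutive (shift u).
Proof.
move=> n; apply: val_inj; rewrite !val_shift.
case: (boolP (val n + u \in E)) => [nu|/negbTE ->] //.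
by rewrite addvvK (valP n).
Qed.

Definition shift_perm (u : V) : {perm {v : W | v \in E}} :=
  perm (inv_inj (shiftK u)).

(** A point [w] of [E] is shifted exactly when [B u w = Q u]. If both points are shifted, the two
    extra terms [Q u] cancel; if only one is, the other pairs with [u] to [Q u + 1], which is the
    sign [z]. *)
Lemma chi_shift (u v w : V) : v \in E -> w \in E ->
  let z x := if x + u \in E then sg (Q u + 1) else 1 in
  chi B R (if v + u \in E then v + u else v) (if w + u \in E then w + u else w)
    = z v * z w * chi B R v w.
Proof.
move=> vE wE; rewrite /= !mem_level_shift // /chi -!/(sg _).
case: eqP => Bv; case: eqP => Bw; rewrite ?mulr1 ?mul1r -?sgD //.
- rewrite formDl !formDr symplectic_alt [B v u]symplecticC Bv Bw; congr (sg _).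
  by rewrite F2_addxx add0r addr0 -addrA F2_addxx addr0.
- rewrite formDl; congr (sg _); apply/eqP; move/eqP: Bw.
  by case: (F2_cases (B u w)) => ->; case: (F2_cases (Q u)) => ->;
     case: (F2_cases (B v w)) => ->.
- rewrite formDr [B v u]symplecticC; congr (sg _); apply/eqP; move/eqP: Bv.
  by case: (F2_cases (B u v)) => ->; case: (F2_cases (Q u)) => ->;
     case: (F2_cases (B v w)) => ->.
Qed.

(** Here the shift by [p + q] would move [n], so [p] is sent to [q] through an intermediate point
    [w], by two shifts that both fix [n]. *)
Lemma level_two_step (n p q : V) : n \in E -> p \in E -> q \in E ->
  p != n -> q != n -> n + (p + q) \in E ->
  exists2 w, w \in E & (n + (p + w) \notin E) && (n + (w + q) \notin E).
Proof.
move=> nE pE qE pn qn npq.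
have [||x [ax bx]] := @symplectic_neq0_2 (p + n) (q + n); rewrite ?addv_eq0 //.
(* Three copies of [e] add up to [e], so only the pairings decide membership. *)
have mem_sum3 (u v w : V) : u \in E -> v \in E -> w \in E ->
    (u + (v + w) \in E) = (B u v + B u w + B v w == 0).
  rewrite !EQ !yieldsD formDr => /eqP -> /eqP -> /eqP ->.
  by case: (F2_cases (B u v)) => ->; case: (F2_cases (B u w)) => ->;
     case: (F2_cases (B v w)) => ->; case: (F2_cases e) => ->.
(* Since [B x n] and [B x p] differ, exactly one of them equals [Q x], so exactly one of [n + x] and
   [p + x] lies in [E]. *)
have wE : (if n + x \in E then n + x else p + x) \in E.
  case: ifP => // /negP; rewrite !mem_level_shift // => nx.
  move: ax nx => /eqP; rewrite symplecticC formDr.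
  by case: (F2_cases (B x n)) => ->; case: (F2_cases (B x p)) => ->;
     case: (F2_cases (Q x)) => ->.
exists (if n + x \in E then n + x else p + x) => //.
(* For either choice of [w] both pairing sums reduce to 1 by the choice of [x]; for [w = p + x] this
   also uses [npq]. *)
rewrite !mem_sum3 //; move: npq ax bx => + /eqP + /eqP; rewrite mem_sum3 // !formDl.
case: ifP => _; rewrite !formDl !formDr ?symplectic_alt ?[B p n]symplecticC
  [B x q]symplecticC.
  by case: (F2_cases (B n p)) => ->; case: (F2_cases (B n q)) => ->;
     case: (F2_cases (B p q)) => ->; case: (F2_cases (B n x)) => ->;
     case: (F2_cases (B p x)) => ->; case: (F2_cases (B q x)) => ->.
by case: (F2_cases (B n p)) => ->; case: (F2_cases (B n q)) => ->;
   case: (F2_cases (B p q)) => ->; case: (F2_cases (B n x)) => ->;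
   case: (F2_cases (B p x)) => ->; case: (F2_cases (B q x)) => ->.
Qed.

(** * Sequences with Gram matrix [a] times the identity plus [s] times the sign matrix *)

Section Frame.
Variables (H : lmodType R) (dot : {dot H for idfun}).
Variables (f : {v : W | v \in E} -> H) (a s : R).
Hypothesis gram : forall v w,
  dot (f v) (f w) = a * (v == w)%:R + s * chi B R (val v) (val w).

Lemma is_symmetry_shift (u : V) : is_symmetry dot f (shift_perm u).
Proof.
exists (fun n => if val n + u \in E then sg (Q u + 1) else 1); split.
  by move=> n; case: ifP => _; rewrite ?norm_sg ?normr1.
move=> n1 n2 n12; rewrite !gram (inj_eq perm_inj) (negbTE n12) mulr0 !add0r !permE.
by rewrite !val_shift chi_shift ?(valP n1) ?(valP n2) // [RHS]mulrCA.
Qed.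

Lemma shift_perm_swap (p q : {v : W | v \in E}) : shift_perm (val p + val q) p = q.
Proof.
apply: val_inj; rewrite permE val_shift.
by rewrite (_ : val p + (val p + val q) = val q) ?(valP q) // addrA addvv add0r.
Qed.

Lemma shift_perm_fix (u : V) (n : {v : W | v \in E}) :
  val n + u \notin E -> shift_perm u n = n.
Proof. by move=> /negbTE nu; apply: val_inj; rewrite permE val_shift nu. Qed.

Lemma level_doubly_transitive : doubly_transitive_symmetries dot f.
Proof.
(* The stabilizer of a point is transitive on the other points; it is combined below with one shift
   carrying [n1] to [n3]. *)
have stab (n p q : {v : W | v \in E}) : p != n -> q != n ->
    exists s0, [/\ is_symmetry dot f s0, s0 n = n & s0 p = q].
  move=> pn qn; have [npq|npq] := boolP (val n + (val p + val q) \in E); last first.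
    exists (shift_perm (val p + val q)).
    by rewrite shift_perm_fix ?shift_perm_swap //; split=> //; exact: is_symmetry_shift.
  have [w wE /andP[npw nwq]] := level_two_step (valP n) (valP p) (valP q) pn qn npq.
  exists (shift_perm (val p + w) * shift_perm (w + val q))%g.
  split; first by apply: is_symmetryM; exact: is_symmetry_shift.
    by rewrite permM !shift_perm_fix.
  by rewrite permM -[w]/(val (Sub w wE : {v : W | v \in E})) !shift_perm_swap.
move=> n1 n2 n3 n4 n12 n34.
pose s1 := shift_perm (val n1 + val n3).
have s1n1 : s1 n1 = n3 by exact: shift_perm_swap.
have [||s2 [s2sym s2n3 s2n4]] := stab n3 (s1 n2) n4.
- by rewrite -s1n1 (inj_eq perm_inj) eq_sym.
- by rewrite eq_sym.
exists (s1 * s2)%g; split; last 2 first.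
- by rewrite permM s1n1.
- by rewrite permM.
by apply: is_symmetryM => //; exact: is_symmetry_shift.
Qed.

(** Squaring the Gram matrix with the quadratic equation of the sign matrix and matching
    coefficients with [A] times the Gram matrix gives two conditions: the sign part determines [A],
    as [s ^+ 2 = 1], and the identity part is the hypothesis on [A * a]. *)
Lemma level_ETF_DTETF : s ^+ 2 = 1 -> 0 < a + s -> (1 < #|E|)%N ->
  let A := 2 * a + s * (2 * #|E|%:R - #|W|%:R) / 2 in
  0 < A -> A * a = a ^+ 2 + #|W|%:R / 2 ->
  is_ETF dot f /\ is_DTETF dot f.
Proof.
move=> s2 as_gt0 E_gt1 A A_gt0 Aa.
have chi_diag v : chi B R v v = 1 by rewrite /chi symplectic_alt.
have eqn : equal_norm dot f.
  exists (a + s) => // n.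
  by rewrite hnorm_sqr gram eqxx chi_diag !mulr1.
have equi : equiangular dot f.
  exists 1 => // n1 n2 n12; rewrite gram (negbTE n12) mulr0 add0r normrM.
  by rewrite norm_sg mulr1 real_normK ?num_real.
have tight : tight_for_span dot f.
  apply: (tight_for_span_gram A_gt0) => k m.
  have sum_delta (F : {v : W | v \in E} -> R) l :
      \sum_n (n == l)%:R * F n = F l.
    rewrite (bigD1 l) //= eqxx mul1r big1 ?addr0 // => n /negbTE ->.
    by rewrite mul0r.
  have := sum_chi_level (valP k) (valP m).
  rewrite -(sum_sig E (fun x : W => chi B R (val k) x * chi B R x (val m))).
  set C := \sum_x _ => Csq.
  transitivity (a * (a * (k == m)%:R + s * chi B R (val k) (val m)) +
     a * (s * chi B R (val k) (val m)) + s ^+ 2 * C).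
    rewrite /C mulr_sumr.
    (* The two terms with a factor [a] are written back as sums against a delta, so that the
       identity can be checked summand by summand. *)
    rewrite -[X in _ + a * X + _](sum_delta (fun n => s * chi B R (val k) (val n))).
    rewrite -[X in a * X + _ + _](sum_delta
      (fun n => a * (n == m)%:R + s * chi B R (val n) (val m))).
    rewrite !mulr_sumr -!big_split; apply: eq_bigr => n _ /=.
    rewrite !gram [k == n]eq_sym; ring.
  have -> : C = (#|W|%:R * (k == m)%:R
      + (2 * #|E|%:R - #|W|%:R) * chi B R (val k) (val m)) / 2.
    by rewrite -[k == m]val_eqE -Csq; field.
  rewrite gram s2 mul1r (mulrDr A) (mulrA A) Aa /A.
  by field: s2.
have dep : ~ lin_indep f.
  have /card_gt1P [n1 [n2 [_ _ n12]]] : (1 < #|{: {v : W | v \in E}}|)%N.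
    by rewrite card_sig.
  exact: (tight_equiangular_dependent n12 equi tight).
split; first by split.
by split; [| exact: dependent_span_dim | exact: level_doubly_transitive].
Qed.

End Frame.
End LevelSet.
End Symplectic.

(** * Cardinalities and the four sequences *)

Lemma card_finvect (F : finFieldType) (V : vectType F) :
  #|finvect_type V| = (#|F| ^ \dim {:V})%N.
Proof.
case: V => T cT; rewrite -(@card_vspace F (finvect_type (Vector.Pack cT)) cT fullv).
by rewrite card_vspacef.
Qed.

Theorem theorem5p6 (R : realType) (J : nat) (J_ge2 : (2 <= J)%N)
    (V : vectType 'F_2) (dimV : \dim {:V} = (2 * J)%N)
    (B : {skew_symmetric V}) (B_symplectic : is_psymplectic B)
    (D : {set finvect_type V}) (D_quadric : affine_quadric B D)
    (card_D : #|D| = (2 ^ J.-1 * (2 ^ J + 1))%N) :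
  [/\ is_ETF (@edot R _) (Phi_compl B R J D) /\
      is_DTETF (@edot R _) (Phi_compl B R J D),
      forall (H : lmodType R) (dot : {dot H for idfun})
             (f : {v : finvect_type V | v \in ~: D} -> H),
        hilbert dot -> is_dual_Phi B J dot f ->
        is_ETF dot f /\ is_DTETF dot f,
      is_ETF (@edot R _) (Psi_quadric B R J D) /\
      is_DTETF (@edot R _) (Psi_quadric B R J D)
    & forall (H : lmodType R) (dot : {dot H for idfun})
             (f : {v : finvect_type V | v \in D} -> H),
        hilbert dot -> is_dual_Psi B J dot f ->
        is_ETF dot f /\ is_DTETF dot f].
Proof.
(* If the complement of [D] is the quadric of [Q], then [D] is the level set of [Q] at 1. *)
have [Q [e [QB DQ]]] : exists Q e, yields B Q /\
    forall v : finvect_type V, (v \in D) = (Q v == e).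
  case: D_quadric => Q QB DQ; exists Q.
  case: DQ => DQ; [exists 0 | exists 1]; split=> // v.
    by rewrite DQ finset.inE.
  have := finset.in_setC v D; rewrite DQ finset.inE.
  by case: (v \in D); case: (F2_cases (Q v)) => ->.
have DcQ (v : finvect_type V) : (v \in ~: D) = (Q v == e + 1).
  rewrite finset.in_setC DQ.
  by case: (F2_cases (Q v)) => ->; case: (F2_cases e) => ->.
have J_gt0 : (0 < J)%N by exact: leq_trans J_ge2.
(* All sizes and Gram entries become polynomials in [h]; in each of the four cases the frame
   constant [A] is [3 * h]. *)
pose h : R := 2 ^+ J.-1.
have h_ge2 : 2 <= h.
  by rewrite -[leLHS]expr1 ler_weXn2l ?ler1n // -ltnS prednK.
have EJ : 2 ^+ J = 2 * h by rewrite -exprS prednK.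
have cardV : #|finvect_type V|%:R = 4 * h ^+ 2.
  rewrite card_finvect dimV card_Fp //.
  by rewrite mulnC expnM !natrX EJ; ring.
have h_neq0 : h != 0 by apply/eqP; lra.
have chi_diag v : chi B R v v = 1 by rewrite /chi symplectic_alt.
have cardD : #|D|%:R = h * (2 * h + 1).
  by rewrite card_D natrM natrD !natrX EJ.
have cardDc : #|~: D|%:R = h * (2 * h - 1).
  have := congr1 (fun n => n%:R : R) (finset.cardsC D).
  rewrite natrD cardV cardD => /(canRL (addKr _)) ->; ring.
have notinD (x : {x : finvect_type V | x \in ~: D}) : val x \notin D.
  by rewrite -finset.in_setC (valP x).
have notinDc (x : {x : finvect_type V | x \in D}) : val x \notin ~: D.
  by rewrite finset.in_setC negbK (valP x).
have gt1 (n : nat) : n%:R >= (2 : R) -> (1 < n)%N by rewrite ler_nat.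
split.
- apply: (level_ETF_DTETF B_symplectic QB DcQ (a := 2 * h) (s := 1)).
  + move=> v w.
    (* The vectors have coordinates in [D] but indices off [D], so the inner product is a sum over
       [D]. *)
    apply: (etrans (edot_chi_vec_level R B_symplectic QB DQ J_gt0
      (notinD v) (notinD w))).
    by rewrite cardV cardD val_eqE -/h; field.
  + by rewrite expr1n.
  + lra.
  + apply: gt1; rewrite cardDc; nra.
  + rewrite cardV cardDc; nra.
  + by rewrite cardV cardDc; field.
- move=> H dot f _ gram.
  apply: (level_ETF_DTETF B_symplectic QB DcQ (a := h) (s := -1)).
  + move=> v w; rewrite gram; case: eqVneq => [->|_]; rewrite ?chi_diag /h /=; ring.
  + by rewrite sqrrN expr1n.
  (* The squared norm is [h - 1], positive because [h] is at least 2. *)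
  + lra.
  + apply: gt1; rewrite cardDc; nra.
  + rewrite cardV cardDc; nra.
  + by rewrite cardV cardDc; field.
- apply: (level_ETF_DTETF B_symplectic QB DQ (a := 2 * h) (s := -1)).
  + move=> v w.
    apply: (etrans (edot_chi_vec_level R B_symplectic QB DcQ J_gt0
      (notinDc v) (notinDc w))).
    by rewrite cardV cardDc val_eqE -/h; field.
  + by rewrite sqrrN expr1n.
  + lra.
  + apply: gt1; rewrite cardD; nra.
  + rewrite cardV cardD; nra.
  + by rewrite cardV cardD; field.
- move=> H dot f _ gram.
  apply: (level_ETF_DTETF B_symplectic QB DQ (a := h) (s := 1)).
  + move=> v w; rewrite gram; case: eqVneq => [->|_]; rewrite ?chi_diag /h /=; ring.
  + by rewrite expr1n.
  + lra.
  + apply: gt1; rewrite cardD; nra.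
  + rewrite cardV cardD; nra.
  + by rewrite cardV cardD; field.
Qed.
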